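(* Let $\alpha_i:(F_0,A_0)\to(F_i,A_i)$, $i=1,2$, be morphisms of relative graphs and let $(E,A)$ be their pushout. If $(\alpha_1,\alpha_2)$ is admissible, then: (1) $G(F_1,A_1)^{(0)}\cup G(F_2,A_2)^{(0)}=G(E,A)^{(0)}$; (2) $G(F_1,A_1)^{(0)}\cap G(F_2,A_2)^{(0)}=G(F_0,A_0)^{(0)}$.
   Context: A directed graph $E=(E^0,E^1,r,s)$ has vertex set $E^0$, edge set $E^1$ and range and source maps $r,s:E^1\to E^0$; $\operatorname{reg}(E)=\{v\in E^0:0<|s^{-1}(v)|<\infty\}$. A finite path of length $n\ge1$ is a sequence $e_1\cdots e_n$ of edges with $r(e_i)=s(e_{i+1})$, and its range is $r(e_n)$; vertices are the paths of length $0$, with $r(v)=v$. $E^*$ is the set of finite paths and $E^\infty$ the set of infinite paths. A relative graph is a pair $(E,R)$ with $E$ a directed graph and $R\subseteq\operatorname{reg}(E)$. The unit space of the relative boundary path groupoid $G(E,R)$ is the relative boundary path space $$G(E,R)^{(0)}=\partial_RE:=E^\infty\cup\{u\in E^*: r(u)\notin R\}.$$ A subset $H\subseteq E^0$ is hereditary in $E$ if $s(e)\in H$ implies $r(e)\in H$ for all $e\in E^1$. A morphism of relative graphs $\alpha:(F,B)\to(E,A)$ is an injective graph homomorphism $F\hookrightarrow E$, viewed as an inclusion, such that (i) $E^0\setminus F^0$ is hereditary in $E$; (ii) $F^1=F^0E^1F^0:=\{e\in E^1: s(e),r(e)\in F^0\}$; (iii) $A\cap F^0\subseteq B$. The pushout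 of $\alpha_1,\alpha_2$ is the relative graph $(E,A)$ where $E=F_1\sqcup_{F_0}F_2$, that is, $E^0=(F_1^0\sqcup F_2^0)/\{\alpha_1(v)=\alpha_2(v):v\in F_0^0\}$, $E^1=(F_1^1\sqcup F_2^1)/\{\alpha_1(e)=\alpha_2(e):e\in F_0^1\}$, with range and source maps induced from those of $F_1,F_2$, and $$A=(A_1\setminus F_0^0)\cup(A_2\setminus F_0^0)\cup(A_1\cap A_2).$$ Here $F_0,F_1,F_2$ are regarded as subgraphs of $E$ (with $F_1\cap F_2=F_0$), and their paths as paths in $E$; the unions and intersections in the claim are taken among paths of $E$. The pair $(\alpha_1,\alpha_2)$ is admissible if $A_0\subseteq A_1\cup A_2$. *)

(* Defs.v *)
From Stdlib Require Import Relation_Operators.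
From HB Require Import structures.
From mathcomp Require Import all_boot all_classical.

Set Implicit Arguments.
Unset Strict Implicit.
Unset Printing Implicit Defensive.

Local Open Scope classical_set_scope.
Local Open Scope quotient_scope.

Record digraph := Digraph {
  vert : Type;
  edge : Type;
  src : edge -> vert;
  rng : edge -> vert }.
Arguments src {_} _.
Arguments rng {_} _.

Definition regular (E : digraph) : set (vert E) :=
  [set v | src @^-1` [set v] !=set0 /\ finite_set (src @^-1` [set v])].
Arguments regular : clear implicits.

Definition hereditary (E : digraph) (H : set (vert E)) : Prop :=
  forall e : edge E, H (src e) -> H (rng e).

Record relgraph := RelGraph {
  rel_graph :> digraph;
  rel_set : set (vert rel_graph);
  rel_set_regular : rel_set `<=` regular rel_graph }.
Arguments rel_set : clear implicits.

(* Words carry no composability constraint; the paths are singled out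
   among them by [finite_path] and [infinite_path].  The word
   [Edges e1 [:: e2; ...; en]] stands for e1 e2 ... en, so its length is
   at least 1. *)
Inductive finword (E : digraph) :=
  | Vertex of vert E
  | Edges of edge E & seq (edge E).

Definition infword (E : digraph) := nat -> edge E.

Definition finite_path (E : digraph) : set (finword E) :=
  [set u | match u with
           | Vertex _ => True
           | Edges e es => path (fun x y => `[< rng x = src y >]) e es
           end].
Arguments finite_path : clear implicits.

Definition infinite_path (E : digraph) : set (infword E) :=
  [set x | forall n, rng (x n) = src (x n.+1)].
Arguments infinite_path : clear implicits.

Definition path_range (E : digraph) (u : finword E) : vert E :=
  match u with
  | Vertex v => v
  | Edges e es => rng (last e es)
  end.

(* The unit space G(E, R)^(0) of the relative boundary path groupoid. *)
Definition boundary_path_space (E : relgraph) : set (finword E + infword E) :=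
  inr @` infinite_path E `|`
  inl @` [set u | finite_path E u /\ ~ rel_set E (path_range u)].
Arguments boundary_path_space : clear implicits.

Record graph_hom (F E : digraph) := GraphHom {
  hom_vert : vert F -> vert E;
  hom_edge : edge F -> edge E;
  hom_src : forall e, src (hom_edge e) = hom_vert (src e);
  hom_rng : forall e, rng (hom_edge e) = hom_vert (rng e) }.

Definition comp_hom (G F E : digraph) (g : graph_hom F E) (f : graph_hom G F) :
  graph_hom G E.
Proof.
exists (hom_vert g \o hom_vert f) (hom_edge g \o hom_edge f) => e /=.
- by rewrite !hom_src.
- by rewrite !hom_rng.
Defined.

Definition map_finword (F E : digraph) (f : graph_hom F E) (u : finword F) :
    finword E :=
  match u with
  | Vertex v => Vertex (hom_vert f v)
  | Edges e es => Edges (hom_edge f e) (map (hom_edge f) es)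
  end.

Definition map_word (F E : digraph) (f : graph_hom F E)
    (w : finword F + infword F) : finword E + infword E :=
  match w with
  | inl u => inl (map_finword f u)
  | inr x => inr (hom_edge f \o x)
  end.

(* Since [F] is viewed as a subgraph of [E], the subsets F^0, F^1 and B
   of E^0, E^1 and E^0 are the images under the homomorphism. *)
Record relmorphism (F E : relgraph) := RelMorphism {
  mor_hom :> graph_hom F E;
  mor_vert_inj : injective (hom_vert mor_hom);
  mor_edge_inj : injective (hom_edge mor_hom);
  mor_hereditary : hereditary (~` range (hom_vert mor_hom));
  mor_full : range (hom_edge mor_hom) =
    [set e | range (hom_vert mor_hom) (src e) /\
             range (hom_vert mor_hom) (rng e)];
  mor_rel_set : rel_set E `&` range (hom_vert mor_hom) `<=`
                hom_vert mor_hom @` rel_set F }.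

(* The quotient (T1 + T2) / {f1 t = f2 t : t in T0}. *)
Section Amalgam.
Variables (T0 T1 T2 : Type) (f1 : T0 -> T1) (f2 : T0 -> T2).

Inductive glue_step : T1 + T2 -> T1 + T2 -> Prop :=
  GlueStep t : glue_step (inl (f1 t)) (inr (f2 t)).

Definition glue : rel {classic (T1 + T2)} :=
  fun x y => `[< clos_refl_sym_trans _ glue_step x y >].

Lemma glue_refl : reflexive glue.
Proof. by move=> x; apply/asboolP; apply: rst_refl. Qed.

Lemma glue_sym : symmetric glue.
Proof.
by move=> x y; apply/asboolP/asboolP => h; apply: rst_sym.
Qed.

Lemma glue_trans : transitive glue.
Proof.
by move=> y x z /asboolP h /asboolP k; apply/asboolP; apply: rst_trans h k.
Qed.

Canonical glue_equiv := EquivRel glue glue_refl glue_sym glue_trans.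

Definition amalgam : Type := {eq_quot glue}.

Definition amalgam_in1 (x : T1) : amalgam := \pi_{eq_quot glue} (inl x).
Definition amalgam_in2 (x : T2) : amalgam := \pi_{eq_quot glue} (inr x).

Lemma amalgam_glue t : amalgam_in1 (f1 t) = amalgam_in2 (f2 t).
Proof. by apply/eqmodP/asboolP; apply: rst_step. Qed.

Lemma amalgamP (a : amalgam) :
  (exists x, a = amalgam_in1 x) \/ (exists y, a = amalgam_in2 y).
Proof.
rewrite -[a]reprK; case: (repr a : T1 + T2) => x.
- by left; exists x.
- by right; exists x.
Qed.

Lemma amalgam_eqP (x y : {classic (T1 + T2)}) :
  \pi_{eq_quot glue} x = \pi_{eq_quot glue} y <->
  clos_refl_sym_trans _ glue_step x y.
Proof.
split=> [/eqmodP/asboolP //|h].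
by apply/eqmodP/asboolP.
Qed.

Lemma glue_invariant (P : Type) (g : T1 + T2 -> P) :
  (forall t, g (inl (f1 t)) = g (inr (f2 t))) ->
  forall x y, clos_refl_sym_trans _ glue_step x y -> g x = g y.
Proof.
move=> gE x y; elim=> {x y} //.
- by move=> x y [t].
- by move=> x y z _ -> _ ->.
Qed.

(* Computed on a representative; independent of it as soon as
   g1 \o f1 =1 g2 \o f2, see [amalgam_lift1] and [amalgam_lift2]. *)
Definition amalgam_lift (P : Type) (g1 : T1 -> P) (g2 : T2 -> P)
    (a : amalgam) : P :=
  match repr (a : {eq_quot glue}) : T1 + T2 with
  | inl x => g1 x
  | inr y => g2 y
  end.

Section Lift.
Variables (P : Type) (g1 : T1 -> P) (g2 : T2 -> P).
Hypothesis g12 : forall t, g1 (f1 t) = g2 (f2 t).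

Lemma amalgam_lift_pi (x : T1 + T2) :
  amalgam_lift g1 g2 (\pi_{eq_quot glue} x) =
  match x with inl x => g1 x | inr y => g2 y end.
Proof.
rewrite /amalgam_lift.
apply: (@glue_invariant _ (fun z => match z with
  | inl x => g1 x | inr y => g2 y end)) => //.
by apply/amalgam_eqP; rewrite reprK.
Qed.

Lemma amalgam_lift1 x : amalgam_lift g1 g2 (amalgam_in1 x) = g1 x.
Proof. exact: amalgam_lift_pi. Qed.

Lemma amalgam_lift2 y : amalgam_lift g1 g2 (amalgam_in2 y) = g2 y.
Proof. exact: amalgam_lift_pi. Qed.

End Lift.

Section Injective.
Hypotheses (f1_inj : injective f1) (f2_inj : injective f2).

Let normal (x y : T1 + T2) : Prop :=
  match x, y with
  | inl a, inl b => a = b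
  | inr a, inr b => a = b
  | inl a, inr b => exists2 t, a = f1 t & b = f2 t
  | inr b, inl a => exists2 t, a = f1 t & b = f2 t
  end.

Lemma glue_normal x y : clos_refl_sym_trans _ glue_step x y -> normal x y.
Proof.
elim=> {x y}.
- by move=> x y [t]; exists t.
- by case.
- by case=> a [] b //= ? <-.
- case=> a [] b [] c //= _.
  + by move=> -> _ ->.
  + by move=> ->.
  + move=> [t -> ->] _ [u -> /f2_inj ->] //.
  + by move=> [t -> ->] _ <-; exists t.
  + by move=> [t -> ->] _ <-; exists t.
  + by move=> [t -> ->] _ [u /f1_inj -> ->].
  + by move=> ->.
  + by move=> -> _ ->.
Qed.

Lemma amalgam_in1_inj : injective amalgam_in1.
Proof. by move=> x y /amalgam_eqP/glue_normal. Qed.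

Lemma amalgam_in2_inj : injective amalgam_in2.
Proof. by move=> x y /amalgam_eqP/glue_normal. Qed.

Lemma amalgam_in12 x y : amalgam_in1 x = amalgam_in2 y ->
  exists2 t, x = f1 t & y = f2 t.
Proof. by move=> /amalgam_eqP/glue_normal. Qed.

End Injective.
End Amalgam.

Section Pushout.
Variables (F0 F1 F2 : relgraph).
Variables (a1 : relmorphism F0 F1) (a2 : relmorphism F0 F2).

Local Notation V := (amalgam (hom_vert a1) (hom_vert a2)).
Local Notation D := (amalgam (hom_edge a1) (hom_edge a2)).
Local Notation inV1 := (amalgam_in1 (hom_vert a1) (hom_vert a2)).
Local Notation inV2 := (amalgam_in2 (hom_vert a1) (hom_vert a2)).

Definition pushout_graph : digraph := {|
  vert := V;
  edge := D;
  src := amalgam_lift (inV1 \o @src F1) (inV2 \o @src F2);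
  rng := amalgam_lift (inV1 \o @rng F1) (inV2 \o @rng F2) |}.

Lemma pushout_src_glue e :
  (inV1 \o @src F1) (hom_edge a1 e) = (inV2 \o @src F2) (hom_edge a2 e).
Proof. by rewrite /= !hom_src; exact: amalgam_glue. Qed.

Lemma pushout_rng_glue e :
  (inV1 \o @rng F1) (hom_edge a1 e) = (inV2 \o @rng F2) (hom_edge a2 e).
Proof. by rewrite /= !hom_rng; exact: amalgam_glue. Qed.

Definition pushout_in1 : graph_hom F1 pushout_graph.
Proof.
exists inV1 (amalgam_in1 (hom_edge a1) (hom_edge a2)) => e.
- exact: (amalgam_lift1 pushout_src_glue).
- exact: (amalgam_lift1 pushout_rng_glue).
Defined.

Definition pushout_in2 : graph_hom F2 pushout_graph.
Proof.
exists inV2 (amalgam_in2 (hom_edge a1) (hom_edge a2)) => e.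
- exact: (amalgam_lift2 pushout_src_glue).
- exact: (amalgam_lift2 pushout_rng_glue).
Defined.

Definition pushout_in0 : graph_hom F0 pushout_graph := comp_hom pushout_in1 a1.

(* The vertex sets and relative sets of F0, F1, F2 as subsets of E^0. *)
Local Notation F0V := (range (hom_vert pushout_in0)).
Local Notation A0 := (hom_vert pushout_in0 @` rel_set F0).
Local Notation A1 := (hom_vert pushout_in1 @` rel_set F1).
Local Notation A2 := (hom_vert pushout_in2 @` rel_set F2).

Definition pushout_rel_set : set (vert pushout_graph) :=
  (A1 `\` F0V) `|` (A2 `\` F0V) `|` (A1 `&` A2).

Lemma pushout_src_in1 (e : edge pushout_graph) (v : vert F1) :
  src e = hom_vert pushout_in1 v ->
  (exists2 e1, e = hom_edge pushout_in1 e1 & src e1 = v) \/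
  (exists2 e2, e = hom_edge pushout_in2 e2 &
     exists2 w, hom_vert a1 w = v & hom_vert a2 w = src e2).
Proof.
case: (amalgamP e) => -[x ->] h.
- left; exists x => //; move: h.
  rewrite -[amalgam_in1 _ _ x]/(hom_edge pushout_in1 x) hom_src.
  by move=> /(amalgam_in1_inj (@mor_vert_inj _ _ a1) (@mor_vert_inj _ _ a2)).
- right; exists x => //; move: h.
  rewrite -[amalgam_in2 _ _ x]/(hom_edge pushout_in2 x) hom_src => /esym.
  move=> /(amalgam_in12 (@mor_vert_inj _ _ a1) (@mor_vert_inj _ _ a2)).
  by case=> t -> ->; exists t.
Qed.

Lemma pushout_src_in2 (e : edge pushout_graph) (v : vert F2) :
  src e = hom_vert pushout_in2 v ->
  (exists2 e2, e = hom_edge pushout_in2 e2 & src e2 = v) \/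
  (exists2 e1, e = hom_edge pushout_in1 e1 &
     exists2 w, hom_vert a1 w = src e1 & hom_vert a2 w = v).
Proof.
case: (amalgamP e) => -[x ->] h.
- right; exists x => //; move: h.
  rewrite -[amalgam_in1 _ _ x]/(hom_edge pushout_in1 x) hom_src.
  move=> /(amalgam_in12 (@mor_vert_inj _ _ a1) (@mor_vert_inj _ _ a2)).
  by case=> t -> ->; exists t.
- left; exists x => //; move: h.
  rewrite -[amalgam_in2 _ _ x]/(hom_edge pushout_in2 x) hom_src.
  by move=> /(amalgam_in2_inj (@mor_vert_inj _ _ a1) (@mor_vert_inj _ _ a2)).
Qed.

Lemma pushout_rel_set_regular : pushout_rel_set `<=` regular pushout_graph.
Proof.
move=> v [[[[v1 A1v1 <-] nF0]|[[v2 A2v2 <-] nF0]]|[[v1 A1v1 <-] [v2 A2v2 v21]]].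
- have [[e he] fin] := rel_set_regular A1v1; split.
    by exists (hom_edge pushout_in1 e); exact: (etrans (hom_src pushout_in1 e) (congr1 _ he)).
  apply: sub_finite_set (finite_image (hom_edge pushout_in1) fin).
  move=> f /pushout_src_in1 [[e1 -> e1v]|[e2 _ [w wv _]]]; first by exists e1.
  by case: nF0; exists w => //=; rewrite wv.
- have [[e he] fin] := rel_set_regular A2v2; split.
    by exists (hom_edge pushout_in2 e); exact: (etrans (hom_src pushout_in2 e) (congr1 _ he)).
  apply: sub_finite_set (finite_image (hom_edge pushout_in2) fin).
  move=> f /pushout_src_in2 [[e2 -> e2v]|[e1 _ [w _ wv]]]; first by exists e2.
  by case: nF0; exists w => //=; rewrite -wv; exact: amalgam_glue.
- have [[e he] fin1] := rel_set_regular A1v1; split.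
    by exists (hom_edge pushout_in1 e); exact: (etrans (hom_src pushout_in1 e) (congr1 _ he)).
  have [_ fin2] := rel_set_regular A2v2.
  apply: (@sub_finite_set _ _ (hom_edge pushout_in1 @` (src @^-1` [set v1]) `|`
                      hom_edge pushout_in2 @` (src @^-1` [set v2]))); last first.
    by rewrite finite_setU; split; exact: finite_image.
  move=> f; rewrite /preimage /= => fv.
  have [[e1 -> e1v]|[e2 -> [w wv w2]]] := pushout_src_in1 fv.
    by left; exists e1.
  right; exists e2 => //=; rewrite -w2.
  apply: (amalgam_in2_inj (@mor_vert_inj _ _ a1) (@mor_vert_inj _ _ a2)).
  by rewrite -amalgam_glue wv; exact/esym.
Qed.

Definition pushout : relgraph := RelGraph pushout_rel_set_regular.

Definition admissible : Prop := A0 `<=` A1 `|` A2.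

End Pushout.

(* Main.v *)
Require Import Defs.
From mathcomp Require Import all_boot all_classical.

Set Implicit Arguments.
Unset Strict Implicit.
Unset Printing Implicit Defensive.

Local Open Scope classical_set_scope.

(** All four inclusions F0 -> Fi -> E are closed under predecessors: an edge
    whose range lies in the subgraph lies in the subgraph. Hence a finite path
    lies in the subgraph as soon as its range does, and an infinite path as soon
    as all its vertices do, so that the boundary path space of a subgraph is cut
    out of the paths of E by conditions on vertices only
    ([image_boundary_path_space]). An infinite path of E which leaves F1 never
    comes back, so from then on it runs in F2, and therefore always did. *)

Definition predecessor_closed (F E : digraph) (f : graph_hom F E) : Prop :=
  forall e, range (hom_vert f) (rng e) -> range (hom_edge f) e.

Section PredecessorClosed.
Variables (F E : digraph) (f : graph_hom F E).
Hypotheses (f_inj : injective (hom_vert f)) (f_closed : predecessor_closed f).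

Lemma predecessor_closed_src e :
  range (hom_vert f) (rng e) -> range (hom_vert f) (src e).
Proof. by move=> /f_closed[e' _ <-]; rewrite hom_src; exists (src e'). Qed.

Lemma infinite_path_src (x : infword E) n k : infinite_path E x ->
  range (hom_vert f) (src (x (n + k))) -> range (hom_vert f) (src (x n)).
Proof.
move=> xP; elim: k => [|k IHk]; first by rewrite addn0.
by rewrite addnS -xP => /predecessor_closed_src.
Qed.

(** Injectivity on vertices reflects the composability of consecutive edges. *)
Lemma finite_path_map u : finite_path E (map_finword f u) <-> finite_path F u.
Proof.
case: u => [//|e es]; rewrite /finite_path /= path_map.
suff /eq_path -> : relpre (hom_edge f) (fun x y => `[< rng x = src y >]) =2
    (fun x y => `[< rng x = src y >]) by [].
move=> x y /=; apply/asboolP/asboolP; rewrite hom_rng hom_src; first exact: f_inj.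
by move=> ->.
Qed.

Lemma path_range_map u :
  path_range (map_finword f u) = hom_vert f (path_range u).
Proof. by case: u => [//|e es] /=; rewrite last_map hom_rng. Qed.

(** Works back from the far end: the last edge lifts because its range does, and the source of a
    lifted tail is the range of the edge before it, which therefore lifts too. *)
Lemma finite_path_lift u : finite_path E u ->
  range (hom_vert f) (path_range u) -> exists u', u = map_finword f u'.
Proof.
case: u => [v _ /= [v' _ <-]|e es]; first by exists (Vertex v').
rewrite /finite_path /=; elim: es e => [|e2 es IHes] e /=.
  by move=> _ /f_closed[e' _ <-]; exists (Edges e' [::]).
case/andP=> /asboolP e_e2 /IHes/[apply]-[[//|e2' es'] [e2E esE]].
have /f_closed[e' _ <-] : range (hom_vert f) (rng e).
  by rewrite e_e2 e2E hom_src; exists (src e2').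
by exists (Edges e' (e2' :: es')); rewrite e2E esE.
Qed.

Lemma infinite_path_lift x : infinite_path E x ->
  (forall n, range (hom_vert f) (src (x n))) ->
  exists2 x', infinite_path F x' & x = hom_edge f \o x'.
Proof.
move=> xP xf.
have /choice[x' x'E] n : exists e, hom_edge f e = x n.
  have /f_closed[e _ <-] : range (hom_vert f) (rng (x n)) by rewrite xP.
  by exists e.
exists x'; last by apply/funext => n /=.
by move=> n; apply: f_inj; rewrite -hom_rng -hom_src !x'E.
Qed.

End PredecessorClosed.

(** Brings the boundary path spaces of all three subgraphs into one form inside [E], so that their
    unions and intersections reduce to facts about vertices. Taking the image of the complement, not
    the complement of the image, keeps the range of a finite path in the subgraph. *)
Lemma image_boundary_path_space (F E : relgraph) (f : graph_hom F E) :
  injective (hom_vert f) -> predecessor_closed f ->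
  map_word f @` boundary_path_space F =
  inr @` [set x | infinite_path E x /\
                  forall n, range (hom_vert f) (src (x n))] `|`
  inl @` [set u | finite_path E u /\
                  (hom_vert f @` (~` rel_set F)) (path_range u)].
Proof.
move=> f_inj f_closed; apply/seteqP; split.
- move=> _ [_ [[x xP <-]|[u [uP uR] <-]] <-].
  + left; exists (hom_edge f \o x) => //; split=> n /=.
      by rewrite hom_rng hom_src xP.
    by rewrite hom_src; exists (src (x n)).
  + right; exists (map_finword f u) => //; split; first exact/finite_path_map.
    by rewrite path_range_map; exists (path_range u).
- move=> _ [[x [xP xf] <-]|[u [uP [v vR vE]] <-]].
  + have [x' x'P ->] := infinite_path_lift f_inj f_closed xP xf.
    by exists (inr x') => //; left; exists x'.
  + have [|u' uE] := finite_path_lift f_closed uP; first by exists v.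
    exists (inl u'); last by rewrite uE.
    right; exists u' => //; split; first by apply/(finite_path_map f_inj); rewrite -uE.
    suff <- : v = path_range u' by [].
    by apply: f_inj; rewrite -path_range_map -uE.
Qed.

(** If the source lay outside the subgraph, heredity of the complement would put the range outside
    too; with both ends inside, fullness supplies the edge. *)
Lemma relmorphism_predecessor_closed {F E : relgraph} (a : relmorphism F E) :
  predecessor_closed a.
Proof.
move=> e e_rng; rewrite mor_full; split=> //.
by apply: contrapT => /mor_hereditary; apply.
Qed.

Section PushoutInclusions.
Variables (F0 F1 F2 : relgraph).
Variables (a1 : relmorphism F0 F1) (a2 : relmorphism F0 F2).

Local Notation i0 := (hom_vert (pushout_in0 a1 a2)).
Local Notation i1 := (hom_vert (pushout_in1 a1 a2)).
Local Notation i2 := (hom_vert (pushout_in2 a1 a2)).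

Lemma pushout_in1_inj : injective i1.
Proof. by apply: amalgam_in1_inj; exact: mor_vert_inj. Qed.

Lemma pushout_in2_inj : injective i2.
Proof. by apply: amalgam_in2_inj; exact: mor_vert_inj. Qed.

Lemma pushout_in0_inj : injective i0.
Proof. by move=> v w /pushout_in1_inj/mor_vert_inj. Qed.

Lemma pushout_in0_in2 v : i0 v = i2 (hom_vert a2 v).
Proof. exact: amalgam_glue. Qed.

Lemma pushout_in12 v w : i1 v = i2 w ->
  exists2 t, v = hom_vert a1 t & w = hom_vert a2 t.
Proof. by apply: amalgam_in12; exact: mor_vert_inj. Qed.

(** An edge of [F2] whose range is in [F1] has that range in [F0]; as [F0] is predecessor closed in
    [F2], the edge is in [F0], hence in [F1]. *)
Lemma pushout_in1_closed : predecessor_closed (pushout_in1 a1 a2).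
Proof.
move=> e [v _]; have [[e1 ->]|[e2 ->]] := amalgamP e; first by exists e1.
rewrite -[amalgam_in2 _ _ e2]/(hom_edge (pushout_in2 a1 a2) e2) hom_rng.
move=> /pushout_in12[t _ e2t].
have [e0 _ <-] : range (hom_edge a2) e2.
  by apply: relmorphism_predecessor_closed; exists t.
by exists (hom_edge a1 e0) => //; exact: amalgam_glue.
Qed.

Lemma pushout_in2_closed : predecessor_closed (pushout_in2 a1 a2).
Proof.
move=> e [v _]; have [[e1 ->]|[e2 ->]] := amalgamP e; last by exists e2.
rewrite -[amalgam_in1 _ _ e1]/(hom_edge (pushout_in1 a1 a2) e1) hom_rng => /esym.
move=> /pushout_in12[t e1t _].
have [e0 _ <-] : range (hom_edge a1) e1.
  by apply: relmorphism_predecessor_closed; exists t.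
by exists (hom_edge a2 e0) => //; apply/esym; exact: amalgam_glue.
Qed.

Lemma pushout_in0_closed : predecessor_closed (pushout_in0 a1 a2).
Proof.
move=> e [v _ ve].
have /pushout_in1_closed[e1 _ e1E] : range i1 (rng e).
  by exists (hom_vert a1 v).
have [e0 _ e0E] : range (hom_edge a1) e1.
  apply: relmorphism_predecessor_closed; exists v => //; apply: pushout_in1_inj.
  by rewrite -hom_rng e1E -ve.
by exists e0 => //; rewrite -e1E -e0E.
Qed.

Lemma pushout_range_in0 : range i1 `&` range i2 = range i0.
Proof.
apply/seteqP; split=> [_ [[v _ <-] [w _ /esym/pushout_in12[t -> _]]]|_ [v _ <-]].
  by exists t.
split; first by exists (hom_vert a1 v).
by exists (hom_vert a2 v) => //; rewrite pushout_in0_in2.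
Qed.

(** Off [F0] a vertex lies in only one of the two graphs, where the pushout set agrees with the set
    of that graph; on [F0] this is De Morgan for the intersection of A1 and A2. *)
Lemma pushout_rel_setC :
  i1 @` (~` rel_set F1) `|` i2 @` (~` rel_set F2) = ~` rel_set (pushout a1 a2).
Proof.
apply/seteqP; split.
- move=> _ [[v vA <-]|[w wA <-]].
  + move=> [[[[v' v'A /pushout_in1_inj v'E] _]|[[w _ wv] nF0]]|[[v' v'A /pushout_in1_inj v'E] _]].
    * by apply: vA; rewrite -v'E.
    * by apply: nF0; rewrite -pushout_range_in0; split; [exists v|exists w].
    * by apply: vA; rewrite -v'E.
  + move=> [[[[v _ vw] nF0]|[[w' w'A /pushout_in2_inj w'E] _]]|[_ [w' w'A /pushout_in2_inj w'E]]].
    * by apply: nF0; rewrite -pushout_range_in0; split; [exists v|exists w].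
    * by apply: wA; rewrite -w'E.
    * by apply: wA; rewrite -w'E.
- move=> z zA.
  have [[v vz]|[w wz]] := amalgamP z.
  + have [vA|vA] := pselect (rel_set F1 v); last by left; exists v.
    have [[t _ tz]|nF0] := pselect (range i0 z); last first.
      by case: zA; left; left; split=> //; exists v.
    (* A vertex of [F0] in A1 but outside the pushout set cannot be in A2, so its copy in [F2] is
       the witness. *)
    right; exists (hom_vert a2 t); last by rewrite -pushout_in0_in2.
    move=> tA; apply: zA; right; split; first by exists v.
    by exists (hom_vert a2 t) => //; rewrite -pushout_in0_in2.
  + have [wA|wA] := pselect (rel_set F2 w); last by right; exists w.
    have [[t _ tz]|nF0] := pselect (range i0 z); last first.
      by case: zA; left; right; split=> //; exists w.
    left; exists (hom_vert a1 t) => //.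
    move=> tA; apply: zA; right; split; last by exists w.
    by exists (hom_vert a1 t).
Qed.

(** From left to right this is admissibility: a vertex of [F0] outside A1 and A2 is outside A0. From
    right to left it is the condition [mor_rel_set] of each morphism. *)
Lemma pushout_rel_set_in0C : admissible a1 a2 ->
  i1 @` (~` rel_set F1) `&` i2 @` (~` rel_set F2) = i0 @` (~` rel_set F0).
Proof.
move=> adm; apply/seteqP; split.
- move=> _ [[v vA <-] [w wA /esym/pushout_in12[t vt wt]]].
  exists t => [tA|]; last by rewrite vt.
  have [|[v' v'A /pushout_in1_inj v'E]|[w' w'A]] := adm (i0 t).
  + by exists t.
  + by apply: vA; rewrite vt -v'E.
  + by rewrite pushout_in0_in2 => /pushout_in2_inj w'E; apply: wA; rewrite wt -w'E.
- move=> _ [t tA <-]; split.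
  + exists (hom_vert a1 t) => // tA1; apply: tA.
    have [|t' t'A /mor_vert_inj <- //] := @mor_rel_set _ _ a1 (hom_vert a1 t).
    by split=> //; exists t.
  + exists (hom_vert a2 t) => [tA2|]; last by rewrite pushout_in0_in2.
    apply: tA.
    have [|t' t'A /mor_vert_inj <- //] := @mor_rel_set _ _ a2 (hom_vert a2 t).
    by split=> //; exists t.
Qed.

Lemma pushout_infinite_path x : infinite_path (pushout_graph a1 a2) x ->
  (forall n, range i1 (src (x n))) \/ (forall n, range i2 (src (x n))).
Proof.
move=> xP; have [|/existsNP[n xn]] := pselect (forall n, range i1 (src (x n))).
  by left.
(* The index [m + n] is past both [m] and [n]: the path cannot be in [F1] there, since it would then
   be in [F1] at [n]; so it is in [F2] there, and hence at [m]. *)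
right=> m; apply: (infinite_path_src pushout_in2_closed (n := m) (k := n) xP).
have [[v vE]|[w ->]] := amalgamP (src (x (m + n))); last by exists w.
case: xn; apply: (infinite_path_src pushout_in1_closed (n := n) (k := m) xP).
by rewrite addnC vE; exists v.
Qed.

End PushoutInclusions.

Theorem proposition4p6 (F0 F1 F2 : relgraph)
    (a1 : relmorphism F0 F1) (a2 : relmorphism F0 F2) :
  admissible a1 a2 ->
  (map_word (pushout_in1 a1 a2) @` boundary_path_space F1 `|`
     map_word (pushout_in2 a1 a2) @` boundary_path_space F2 =
   boundary_path_space (pushout a1 a2)) /\
  (map_word (pushout_in1 a1 a2) @` boundary_path_space F1 `&`
     map_word (pushout_in2 a1 a2) @` boundary_path_space F2 =
   map_word (pushout_in0 a1 a2) @` boundary_path_space F0).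
Proof.
move=> adm.
pose E := pushout a1 a2.
rewrite (@image_boundary_path_space F1 E (pushout_in1 a1 a2)
  (@pushout_in1_inj _ _ _ a1 a2) (@pushout_in1_closed _ _ _ a1 a2)).
rewrite (@image_boundary_path_space F2 E (pushout_in2 a1 a2)
  (@pushout_in2_inj _ _ _ a1 a2) (@pushout_in2_closed _ _ _ a1 a2)).
rewrite (@image_boundary_path_space F0 E (pushout_in0 a1 a2)
  (@pushout_in0_inj _ _ _ a1 a2) (@pushout_in0_closed _ _ _ a1 a2)).
split; apply/seteqP; split.
- move=> _ [] [[x [xP _] <-]|[u [uP uA] <-]].
  + by left; exists x.
  + right; exists u => //; split=> //.
    by rewrite -[~ _]/((~` rel_set (pushout a1 a2)) _) -pushout_rel_setC; left.
  + by left; exists x.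
  + right; exists u => //; split=> //.
    by rewrite -[~ _]/((~` rel_set (pushout a1 a2)) _) -pushout_rel_setC; right.
- move=> _ [[x xP <-]|[u [uP uA] <-]].
  + have [x1|x2] := pushout_infinite_path xP.
    * by left; left; exists x.
    * by right; left; exists x.
  + move: uA; rewrite -[~ _]/((~` rel_set (pushout a1 a2)) _) -pushout_rel_setC.
    by case=> uA; [left|right]; right; exists u.
(* A word common to both sides is finite on both or infinite on both; the mixed cases equate [inl]
   with [inr]. *)
- move=> _ [[[x [xP x1] <-]|[u [uP u1] <-]] [[y [_ y2] //]|[y [_ y2] //]]] => -[yE].
  + left; exists x => //; split=> // n; rewrite -pushout_range_in0.
    by split=> //; rewrite -yE.
  + right; exists u => //; split=> //; rewrite -pushout_rel_set_in0C //.
    by split=> //; rewrite -yE.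
- move=> _ [[x [xP x0] <-]|[u [uP u0] <-]].
  + by split; left; exists x => //; split=> // n;
      move: (x0 n); rewrite -pushout_range_in0 => -[].
  + by move: u0; rewrite -pushout_rel_set_in0C // => -[u1 u2]; split; right; exists u.
Qed.
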